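(* Let $k$ be a nonnegative integer and $\varphi=\frac{1+\sqrt5}{2}$. For $0<x<\varphi-1$, $$\prod_{n=1}^{\infty}(1+x^n)<\frac{1}{x^{k-1}(1+x)^k(1-x-x^2)}-\frac{1}{x^k(1+x)^k}\sum_{n=0}^{2k}\left(F_n-S_{n,k} \right)x^n,$$ where $S_{n,k}=\sum_{j=0}^{k}\binom{k}{j}q(n-k-j)$.
   Context: $q(n)$ denotes the number of partitions of the positive integer $n$ into odd parts; $q(0)=1$ and $q(n)=0$ for negative $n$. $F_n$ is the $n$-th Fibonacci number: $F_0=0$, $F_1=1$, $F_n=F_{n-1}+F_{n-2}$. *)

(* Defs.v *)
From HB Require Import structures.
From mathcomp Require Import all_boot all_order all_algebra.
From mathcomp Require Import all_classical all_reals all_analysis.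

Set Implicit Arguments.
Unset Strict Implicit.
Unset Printing Implicit Defensive.

Import Order.TTheory GRing.Theory Num.Theory.
Import numFieldNormedType.Exports.

(* A partition of n is a multiset of positive integers with sum n, given by its
   multiplicities: [m i] is the number of parts equal to [i.+1]. Every part,
   and every multiplicity, is at most n, so 'I_n and 'I_n.+1 lose nothing. *)
Definition is_partition (n : nat) (m : {ffun 'I_n -> 'I_n.+1}) : bool :=
  \sum_(i < n) m i * i.+1 == n.

Definition has_odd_parts (n : nat) (m : {ffun 'I_n -> 'I_n.+1}) : bool :=
  [forall i : 'I_n, (0 < m i) ==> odd i.+1].

Definition odd_partitions (n : nat) : {set {ffun 'I_n -> 'I_n.+1}} :=
  [set m | is_partition m && has_odd_parts m].

Definition q (z : int) : nat :=
  match z with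
  | Posz n => #|odd_partitions n|
  | Negz _ => 0
  end.

Lemma q0 : q 0 = 1.
Proof.
have m0 (m : {ffun 'I_0 -> 'I_1}) : m \in odd_partitions 0.
  by rewrite inE /is_partition big_ord0 eqxx; apply/forallP => -[].
have -> : q 0 = #|{ffun 'I_0 -> 'I_1}| by apply: eq_card => m; rewrite m0.
by rewrite card_ffun !card_ord.
Qed.

Fixpoint fib (n : nat) : nat :=
  match n with
  | 0 => 0
  | n'.+1 => match n' with
             | 0 => 1
             | n''.+1 => fib n' + fib n''
             end
  end.

(* The difference n - k - j is taken in int, where it may be negative. *)
Definition S_ (n k : nat) : nat :=
  \sum_(0 <= j < k.+1) 'C(k, j) * q (n%:Z - k%:Z - j%:Z)%R.

Local Open Scope ring_scope.

Definition phi (R : realType) : R := (1 + Num.sqrt 5) / 2.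

Definition euler_partial_prod (R : realType) (x : R) (N : nat) : R :=
  \prod_(1 <= n < N.+1) (1 + x ^+ n).

(* Main.v *)
Require Import Defs.
From HB Require Import structures.
From mathcomp Require Import all_boot all_order all_algebra.
From mathcomp Require Import all_classical all_reals all_analysis.
From mathcomp Require Import zify ring lra.
Import Order.TTheory GRing.Theory Num.Theory.
Import numFieldNormedType.Exports.
Local Open Scope classical_set_scope.
Local Open Scope ring_scope.

(** Multiply the inequality by [x ^ k (1 + x) ^ k]. By Euler the product is
    [\sum_n q n x ^ n], so the left side becomes [\sum_n S_ n k x ^ n], while
    [x / (1 - x - x ^ 2) = \sum_n fib n x ^ n]; the claim is then
    [\sum_(n > 2k) S_ n k x ^ n < \sum_(n > 2k) fib n x ^ n]. Since
    [fib n = \sum_j 'C(k, j) fib (n - k - j)], the termwise inequality follows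
    from [q n <= fib n] for [n >= 1], and strictness from [q 4 < fib 4].
    Removing a part gives [q n <= \sum_(p odd) q (n - p)], and [fib] satisfies
    the same recurrence with equality.

    Only the upper bound in Euler's identity is needed, so everything is done
    with finite sums: each partial product lies below the right-hand side by a
    margin that does not depend on the number of factors. *)

Local Arguments fib : simpl never.
Local Arguments q : simpl never.

(** * Partitions into odd parts in a box, and removal of a part *)

(* Parts are indexed from 0: [t] stands for the part [t.+1]. *)
Definition mult_ext K J (m : {ffun 'I_K -> 'I_J.+1}) (t : nat) : nat :=
  if insub t is Some i then m i else 0%N.

(** The box is independent of [n], unlike in [odd_partitions]: removing a part, or expanding a
    product of geometric sums, yields multiplicity functions whose box does not fit their weight. *)
Definition boxed_odd_partitions (K J n : nat) : {set {ffun 'I_K -> 'I_J.+1}} :=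
  [set m : {ffun 'I_K -> 'I_J.+1} | (\sum_(i < K) m i * i.+1 == n)%N
    && [forall i : 'I_K, (0 < m i)%N ==> odd i.+1]].

Lemma mult_extE K J (m : {ffun 'I_K -> 'I_J.+1}) (i : 'I_K) :
  mult_ext K J m i = m i.
Proof. by rewrite /mult_ext valK. Qed.

Lemma mult_ext_out K J (m : {ffun 'I_K -> 'I_J.+1}) t :
  (K <= t)%N -> mult_ext K J m t = 0%N.
Proof. by move=> Kt; rewrite /mult_ext insubF // ltnNge Kt. Qed.

Lemma big_ord_support (G : nat -> nat) (a b : nat) :
  (forall t, (minn a b <= t)%N -> G t = 0%N) ->
  (\sum_(i < a) G i = \sum_(i < b) G i)%N.
Proof.
move=> G0; have tail c : (minn a b <= c)%N ->
    (\sum_(i < c) G i = \sum_(i < minn a b) G i)%N.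
  move=> le_c; rewrite -!(big_mkord xpredT) (big_cat_nat (n := minn a b)) //=.
  by rewrite [X in (_ + X)%N]big_nat [X in (_ + X)%N]big1 ?addn0 // => t /andP[/G0].
by rewrite !tail ?geq_minl ?geq_minr.
Qed.

(** A part times its multiplicity is at most [n], so re-indexing to the box of [odd_partitions n]
    loses nothing and is injective. *)
Lemma card_boxed_odd_partitions K J n :
  (#|boxed_odd_partitions K J n| <= q n)%N.
Proof.
pose e := mult_ext K J.
have sumE m : m \in boxed_odd_partitions K J n -> (\sum_(i < K) e m i * i.+1 = n)%N.
  by rewrite inE => /andP[/eqP <- _]; apply: eq_bigr => i _; rewrite /e mult_extE.
have wle m t : m \in boxed_odd_partitions K J n -> (e m t * t.+1 <= n)%N.
  move=> hm; case: (ltnP t K) => [tK|Kt]; last by rewrite /e mult_ext_out.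
  by rewrite -(sumE m hm) (bigD1 (Ordinal tK)) //= leq_addr.
have ele m t : m \in boxed_odd_partitions K J n -> (e m t < n.+1)%N.
  by move=> /wle-/(_ t); nia.
have eout m t : m \in boxed_odd_partitions K J n -> (n <= t)%N -> e m t = 0%N.
  by move=> /wle-/(_ t); nia.
pose g (m : {ffun 'I_K -> 'I_J.+1}) : {ffun 'I_n -> 'I_n.+1} :=
  [ffun i : 'I_n => inord (e m i)].
have gE m (i : 'I_n) : m \in boxed_odd_partitions K J n -> g m i = e m i :> nat.
  by move=> hm; rewrite ffunE inordK ?ele.
rewrite /q -(card_in_imset (f := g)); last first.
  move=> m1 m2 h1 h2 eqg; apply/ffunP => i; apply: val_inj => /=.
  rewrite -!mult_extE -!/(e _).
  case: (ltnP i n) => [lin|nli]; last by rewrite /e in eout *; rewrite !eout.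
  by rewrite -[nat_of_ord i]/(nat_of_ord (Ordinal lin)) -!gE // eqg.
apply: subset_leq_card; apply/fintype.subsetP => _ /imsetP[m hm ->].
rewrite inE; apply/andP; split.
  apply/eqP; rewrite -[RHS](sumE m hm).
  rewrite (eq_bigr (fun i : 'I_n => e m i * i.+1)%N); last by move=> i _; rewrite gE.
  apply: (big_ord_support (fun t => e m t * t.+1)%N) => t.
  rewrite geq_min => /orP[|] h; first by rewrite eout.
  by rewrite /e mult_ext_out.
apply/forallP => i; apply/implyP; rewrite gE //.
case: (ltnP i K) => [iK|Ki]; last by rewrite /e mult_ext_out.
rewrite -[nat_of_ord i]/(nat_of_ord (Ordinal iK)) /e mult_extE.
by move: hm; rewrite inE => /andP[_ /forallP/(_ (Ordinal iK))/implyP].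
Qed.

(** Removing one copy of the part [p.+1] is injective on partitions that contain it. *)
Lemma card_odd_partitions_part n (p : 'I_n) :
  (#|[set m in odd_partitions n | (0 < m p)%N]| <= q (n - p.+1)%N)%N.
Proof.
apply: leq_trans (card_boxed_odd_partitions n n (n - p.+1)%N).
pose g (m : {ffun 'I_n -> 'I_n.+1}) : {ffun 'I_n -> 'I_n.+1} :=
  [ffun i => if i == p then inord (m p).-1 else m i].
have gp (m : {ffun 'I_n -> 'I_n.+1}) : g m p = (m p).-1 :> nat.
  by rewrite ffunE eqxx inordK // (leq_ltn_trans (leq_pred _)).
have gN (m : {ffun 'I_n -> 'I_n.+1}) i : i != p -> g m i = m i.
  by rewrite ffunE => /negbTE->.
rewrite -(card_in_imset (f := g)); last first.
  move=> m1 m2; rewrite !inE => /andP[_ h1] /andP[_ h2] eqg.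
  apply/ffunP => i; apply: val_inj => /=.
  case: (eqVneq i p) => [->|ip]; last by rewrite -(gN m1) // -(gN m2) // eqg.
  by have := gp m1; rewrite eqg gp; move: h1 h2; case: (val (m1 p)); case: (val (m2 p)) => //; lia.
apply: subset_leq_card; apply/fintype.subsetP => _ /imsetP[m hm ->].
move: hm; rewrite !inE => /andP[/andP[/eqP sm /forallP om] mp].
apply/andP; split.
  rewrite (bigD1 p) //= gp; move: sm; rewrite (bigD1 p) //=.
  rewrite [X in _ -> (_ + X == _)%N](eq_bigr (fun i => m i * i.+1)%N); last by move=> i ip; rewrite gN.
  by case: (m p) mp => -[|a] ia //= _ sm; rewrite -[X in (X - _)%N]sm mulSn -addnA addKn.
apply/forallP => i; case: (eqVneq i p) => [->|ip]; last by rewrite gN.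
by apply/implyP => _; have /implyP := om p; apply.
Qed.

(** * Comparison of [q] with the Fibonacci numbers *)

(** Every partition of a positive [n] is counted at least once on the right, at any one of its
    parts. *)
Lemma q_le_sum n : (0 < n)%N ->
  (q n <= \sum_(p < n | ~~ odd p) q (n - p.+1)%N)%N.
Proof.
move=> n0.
apply: (@leq_trans (\sum_(p < n | ~~ odd p) #|[set m in odd_partitions n | (0 < m p)%N]|)%N); last first.
  by apply: leq_sum => p _; exact: card_odd_partitions_part.
under eq_bigr do rewrite -sum1dep_card.
rewrite (exchange_big_dep [in odd_partitions n]) /=; last by move=> p m _; rewrite inE => /andP[].
rewrite /q -sum1_card; apply: leq_sum => m hm.
move: (hm); rewrite inE => /andP[/eqP sm /forallP om].
have [p mp] : exists p, (0 < m p)%N.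
  apply/existsP; apply: contraT; rewrite negb_exists => /forallP h.
  move: sm; rewrite big1; first by move=> h0; rewrite -h0 in n0.
  by move=> i _; have := h i; rewrite -eqn0Ngt => /eqP->.
have op : ~~ odd p by have /implyP := om p; apply.
by rewrite (bigD1 p) /= ?leq_addr // op mp andbT; move: hm; rewrite inE.
Qed.

(** The induction has step two: in the sum for [n.+3], [p = 0] gives [fib n.+2] and the indices from
    2 on give the sum for [n.+1]. *)
Lemma fib_odd_sum n : (0 < n)%N ->
  (fib n = odd n + \sum_(p < n | ~~ odd p) fib (n - p.+1))%N.
Proof.
have fibS m : fib m.+2 = (fib m.+1 + fib m)%N by [].
elim/ltn_ind: n => -[|[|[|n]]] IH // _.
- by rewrite !big_mkcond !big_ord_recl big_ord0.
- by rewrite !big_mkcond !big_ord_recl big_ord0.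
rewrite fibS (IH n.+1) // big_mkcond [in RHS]big_mkcond /=.
rewrite 2![in RHS]big_ord_recl /=.
rewrite subSS subn0 add0n !negbK addnCA; congr (_ + (_ + _))%N.
apply: eq_bigr => p _; rewrite /bump /= !add1n /= !negbK; congr (if _ then fib _ else _); lia.
Qed.

Lemma q_le_fib n : (0 < n)%N -> (q n <= fib n)%N.
Proof.
elim/ltn_ind: n => n IH n0; apply: leq_trans (q_le_sum n n0) _.
case: n IH n0 => // n IH _.
rewrite (fib_odd_sum n.+1) // big_mkcond [in leqRHS]big_mkcond /=.
(* The last summand is the only one outside the induction hypothesis. There [q 0 = 1] exceeds
   [fib 0 = 0], and the term [odd n.+1] makes up the difference. *)
rewrite !big_ord_recr /= !subnn q0 addnA addnC.
have -> : (if ~~ odd n then 1%N else 0%N) = ~~ odd n :> nat by case: odd.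
rewrite if_same addn0 leq_add2l; apply: leq_sum => i _.
by case: ifP => // _; have := ltn_ord i => /= ilt; apply: IH; lia.
Qed.

(** Every partition of 4 into odd parts contains a 1, so [q 4 <= q 3 <= fib 3 = 2]. *)
Lemma q4_lt_fib4 : (q 4%N < fib 4)%N.
Proof.
apply: (@leq_ltn_trans (q 3%N)); last by rewrite ltnS; exact: q_le_fib.
apply: leq_trans (card_odd_partitions_part 4 ord0).
apply: subset_leq_card; apply/fintype.subsetP => m hm; rewrite inE hm /=.
move: hm; rewrite inE => /andP[/eqP + /forallP om].
rewrite !big_ord_recl big_ord0 /=.
have /implyP := om (lift ord0 ord0); have /implyP := om (lift ord0 (lift ord0 (lift ord0 ord0))).
rewrite /bump /=.
by do 4! move: (nat_of_ord (m _)) => ?; lia.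
Qed.

(** * Binomial sums: from [q] and [fib] to [S_] and [fib] *)

Lemma sum_bin_recl (g : nat -> nat) k :
  (\sum_(i < k.+2) 'C(k.+1, i) * g i = \sum_(i < k.+1) 'C(k, i) * (g i + g i.+1))%N.
Proof.
rewrite big_ord_recl bin0 mul1n.
rewrite (eq_bigr (fun i : 'I_k.+1 => 'C(k, i.+1) * g i.+1 + 'C(k, i) * g i.+1)%N); last first.
  by move=> i _; rewrite lift0 binS mulnDl.
rewrite [RHS](eq_bigr (fun i : 'I_k.+1 => 'C(k, i) * g i + 'C(k, i) * g i.+1)%N); last first.
  by move=> i _; rewrite mulnDr.
rewrite !big_split /= addnA; congr (_ + _)%N.
by rewrite big_ord_recr /= bin_small // mul0n addn0 [RHS]big_ord_recl bin0 mul1n.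
Qed.

(** On the Fibonacci sequence the shift [E] satisfies [E ^ 2 = 1 + E]; this is the [k]-th power of
    that identity. *)
Lemma fib_bin_sum k m : (fib (m + 2 * k) = \sum_(i < k.+1) 'C(k, i) * fib (m + i))%N.
Proof.
elim: k m => [|k IH] m; first by rewrite big_ord1 bin0 mul1n !addn0.
rewrite (sum_bin_recl (fun i => fib (m + i))).
have -> : (m + 2 * k.+1 = (m + 2) + 2 * k)%N by lia.
rewrite IH; apply: eq_bigr => i _; congr (_ * _)%N.
have -> : (m + 2 + i = (m + i).+2)%N by lia.
by rewrite addnS [RHS]addnC.
Qed.

(** Reversing the sum by [j = k - i] makes every argument of [q] the natural number [m + i]. *)
Lemma S_shift m k : S_ (m + 2 * k) k = (\sum_(i < k.+1) 'C(k, i) * q (m + i)%N)%N.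
Proof.
rewrite /S_ big_nat_rev big_mkord; apply: eq_bigr => i _ /=.
have ik := ltn_ord i; rewrite add0n subSS bin_sub //; congr (_ * q _)%N; lia.
Qed.

Lemma S_le_fib n k : (2 * k < n)%N -> (S_ n k <= fib n)%N.
Proof.
move=> h; have -> : n = ((n - 2 * k) + 2 * k)%N by lia.
rewrite S_shift fib_bin_sum; apply: leq_sum => i _.
by rewrite leq_mul2l q_le_fib ?orbT //; lia.
Qed.

Lemma S_lt_fib k : (S_ (4 + 2 * k) k < fib (4 + 2 * k))%N.
Proof.
rewrite S_shift fib_bin_sum !big_ord_recl bin0 !mul1n !addn0 -addSn.
apply: leq_add; first exact: q4_lt_fib4.
by apply: leq_sum => i _; rewrite leq_mul2l q_le_fib ?orbT.
Qed.

(** * A finite upper bound from Euler's identity *)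

Lemma prod_even_odd (R : comRingType) (F : nat -> R) K :
  \prod_(1 <= n < (2 * K)%N) F n =
  (\prod_(0 <= i < K) F (2 * i).+1) * \prod_(1 <= i < K) F (2 * i)%N.
Proof.
case: K => [|K]; first by rewrite !big_geq // mulr1.
elim: K => [|K IH]; first by rewrite !big_nat1 [X in _ * X]big_geq // mulr1.
have -> : (2 * K.+2 = (2 * K.+1).+2)%N by lia.
rewrite 2?big_nat_recr //= IH [in RHS]big_nat_recr //= [\prod_(1 <= i < K.+2) _]big_nat_recr //=.
ring.
Qed.

Lemma geom_double (R : comRingType) (y : R) J :
  (1 + y) * \sum_(0 <= j < J) (y ^+ 2) ^+ j = \sum_(0 <= j < (2 * J)%N) y ^+ j.
Proof.
elim: J => [|J IH]; first by rewrite !big_geq // mulr0.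
have -> : (2 * J.+1 = (2 * J).+2)%N by lia.
by rewrite !big_nat_recr //= -IH -exprM (exprS y (2 * J)); ring.
Qed.

(* Each [n] is uniquely [2 ^ a * m] with [m] odd, and
   [\prod_(a < A) (1 + y ^ 2 ^ a) = \sum_(j < 2 ^ A) y ^ j]: this is Euler's
   odd/distinct correspondence, truncated. *)
Lemma prod_le_odd_geom (R : realFieldType) A (x : R) : 0 <= x ->
  \prod_(1 <= n < (2 ^ A)%N) (1 + x ^+ n) <=
  \prod_(0 <= i < (2 ^ A)%N) \sum_(0 <= j < (2 ^ A)%N) (x ^+ (2 * i).+1) ^+ j.
Proof.
elim: A x => [|A IH] x x0; first by rewrite big_geq // !big_nat1 expr0.
rewrite expnS prod_even_odd; set K := (2 ^ A)%N in IH *.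
have K0 : (0 < K)%N by rewrite expn_gt0.
have ge1 (y : R) J : 0 <= y -> (0 < J)%N -> 1 <= \sum_(0 <= j < J) y ^+ j.
  move=> y0; case: J => // J _; rewrite big_nat_recl // expr0 lerDl.
  by apply: sumr_ge0 => j _; rewrite exprn_ge0.
(* The first [K] geometric factors suffice, the others being at least 1. *)
apply: (@le_trans _ _ (\prod_(0 <= i < K) \sum_(0 <= j < (2 * K)%N) (x ^+ (2 * i).+1) ^+ j)).
  (* With [y = x ^+ (2 * i).+1], each geometric sum is [1 + y] times one in [y ^+ 2]. The factors
     [1 + y] are the odd-indexed ones of the product; the even-indexed ones fall to the induction
     hypothesis at [x ^+ 2]. *)
  under [leRHS]eq_bigr do rewrite -geom_double.
  rewrite big_split /= ler_wpM2l //.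
    by apply: prodr_ge0 => i _; rewrite addr_ge0 ?exprn_ge0.
  under eq_bigr do rewrite exprM.
  apply: le_trans (IH _ _) _; first by rewrite exprn_ge0.
  apply: ler_prod => i _; apply/andP; split.
    by apply: sumr_ge0 => j _; rewrite !exprn_ge0.
  by apply: ler_sum => j _; rewrite (exprAC x 2).
rewrite [leRHS](big_cat_nat (n := K)) //=; last by lia.
apply: ler_peMr; first by apply: prodr_ge0 => i _; apply: sumr_ge0 => j _; rewrite !exprn_ge0.
apply: (big_ind (fun y => 1 <= y)) => // [u v|i _]; last by apply: ge1; rewrite ?exprn_ge0 //; lia.
exact: mulr_ege1.
Qed.

(** Dummy factors 1 let the product run over all parts, as multiplicity functions do. *)
Lemma prod_evens (R : comRingType) (G : nat -> R) K :
  \prod_(0 <= i < K) G (2 * i)%N =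
  \prod_(0 <= i < (2 * K)%N) (if odd i then 1 else G i).
Proof.
elim: K => [|K IH]; first by rewrite !big_geq.
have -> : (2 * K.+1 = (2 * K).+2)%N by lia.
by rewrite !big_nat_recr //= -IH mul2n odd_double /= mulr1.
Qed.

Lemma odd_geom_le_q (R : realFieldType) K J (x : R) : 0 <= x ->
  exists L, \prod_(0 <= i < K) \sum_(0 <= j < J.+1) (x ^+ (2 * i).+1) ^+ j
    <= \sum_(0 <= n < L) (q n)%:R * x ^+ n.
Proof.
move=> x0.
rewrite (prod_evens R (fun i => \sum_(0 <= j < J.+1) (x ^+ i.+1) ^+ j)) big_mkord.
set M := (2 * K)%N.
(* An even part may only have multiplicity 0, so its sum collapses to 1. Distributing the product
   then yields one term per multiplicity function, grouped below by weight. *)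
pose Q (i : 'I_M) := [pred j : 'I_J.+1 | (0 < j)%N ==> odd i.+1].
rewrite (eq_bigr (fun i : 'I_M => \sum_(j < J.+1 | Q i j) (x ^+ i.+1) ^+ j)); last first.
  move=> i _; case: ifP => oi; last first.
    by rewrite big_mkord; apply: eq_bigl => j; rewrite /= oi implybT.
  rewrite (big_pred1 ord0) ?expr0 // => j.
  by rewrite /= oi implybF -eqn0Ngt.
rewrite bigA_distr_big_dep.
pose w (f : {ffun 'I_M -> 'I_J.+1}) := (\sum_(i < M) f i * i.+1)%N.
pose L := (\max_f w f).+1.
have wL f : (w f < L)%N by rewrite ltnS; exact: leq_bigmax.
exists L.
rewrite (partition_big (fun f => Ordinal (wL f)) xpredT) //= big_mkord.
apply: ler_sum => n _.
rewrite (eq_bigr (fun=> x ^+ n)); last first.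
  move=> f /andP[_ /eqP <-] /=; rewrite /w expr_sum.
  by apply: eq_bigr => i _; rewrite -exprM mulnC.
rewrite sumr_const -[leLHS]mulr_natl ler_wpM2r ?exprn_ge0 // ler_nat.
apply: leq_trans (card_boxed_odd_partitions M J n).
apply: subset_leq_card; apply/fintype.subsetP => f.
rewrite !inE => /andP[/familyP ff /eqP <-]; rewrite eqxx /=.
by apply/forallP => i; exact: ff i.
Qed.

Lemma euler_partial_prod_le_q (R : realType) (x : R) N : 0 <= x ->
  exists L, euler_partial_prod x N <= \sum_(0 <= n < L) (q n)%:R * x ^+ n.
Proof.
move=> x0; have [L hL] := odd_geom_le_q R (2 ^ N) (2 ^ N).-1 x x0.
exists L; apply: le_trans hL; rewrite prednK ?expn_gt0 //.
apply: le_trans (prod_le_odd_geom R N x x0).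
(* Since [N < 2 ^ N], the first [N] factors are all present, and the extra ones are at least 1. *)
rewrite /euler_partial_prod [leRHS](big_cat_nat (n := N.+1)) //=; last exact: ltn_expl.
apply: ler_peMr; first by apply: prodr_ge0 => i _; rewrite addr_ge0 ?exprn_ge0.
apply: (big_ind (fun y => 1 <= y)) => // [u v|i _]; first exact: mulr_ege1.
by rewrite lerDl exprn_ge0.
Qed.

(** * Truncated generating functions and the uniform margin *)

Lemma q_sum_mul_le_S_sum (R : realFieldType) (x : R) k L : 0 <= x ->
  x ^+ k * (1 + x) ^+ k * (\sum_(0 <= n < L) (q n)%:R * x ^+ n)
    <= \sum_(0 <= n < (L + 2 * k)%N) (S_ n k)%:R * x ^+ n.
Proof.
move=> x0.
have -> : \sum_(0 <= n < (L + 2 * k)%N) (S_ n k)%:R * x ^+ n =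
    \sum_(j < k.+1) ('C(k, j))%:R *
      \sum_(0 <= n < (L + 2 * k)%N) (q (n%:Z - k%:Z - j%:Z))%:R * x ^+ n.
  under [RHS]eq_bigr do rewrite big_distrr /=.
  rewrite exchange_big /=; apply: eq_bigr => n _.
  rewrite /S_ big_mkord natr_sum big_distrl /=; apply: eq_bigr => j _.
  by rewrite natrM mulrA.
rewrite exprDn [x ^+ k * _]big_distrr /= big_distrl /=; apply: ler_sum => j _.
rewrite expr1n mul1r -mulr_natl mulrCA -mulrA ler_wpM2l ?ler0n // -exprD.
have jk : (j <= k)%N by rewrite -ltnS ltn_ord.
(* The first [k + j] and the last [k - j] terms are dropped as nonnegative; the [L] terms between
   them match after a shift. *)
have -> : (L + 2 * k = (k + j) + (L + (k - j)))%N by lia.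
rewrite [leRHS](big_cat_nat (n := (k + j)%N)) ?leq_addr //=.
rewrite -[leLHS]add0r lerD //.
  by apply: sumr_ge0 => n _; rewrite mulr_ge0 ?ler0n ?exprn_ge0.
rewrite -{2}[(k + j)%N]add0n big_addn addKn [leRHS](big_cat_nat (n := L)) ?leq_addr //=.
rewrite -[leLHS]addr0 lerD //; last first.
  by apply: sumr_ge0 => n _; rewrite mulr_ge0 ?ler0n ?exprn_ge0.
rewrite big_distrr /= le_eqVlt; apply/orP; left; apply/eqP; apply: eq_bigr => n _.
rewrite mulrCA -exprD addnC; congr ((q _)%:R * _); lia.
Qed.

(** The explicit remainder shows that, for [0 <= x] and a positive denominator, the partial sums
    stay below [x / (1 - x - x ^+ 2)]. *)
Lemma fib_sum_mul (R : comRingType) (x : R) M :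
  (1 - x - x ^+ 2) * \sum_(0 <= n < M.+1) (fib n)%:R * x ^+ n
   = x - (fib M.+1)%:R * x ^+ M.+1 - (fib M)%:R * x ^+ M.+2.
Proof.
elim: M => [|M IH].
  by rewrite big_nat1 /fib expr1; ring.
rewrite big_nat_recr //= mulrDr IH.
have -> : fib M.+2 = (fib M.+1 + fib M)%N by [].
by rewrite natrD !exprS; ring.
Qed.

Lemma golden_denominator_gt0 (R : realType) (x : R) :
  0 < x -> x < phi R - 1 -> 0 < 1 - x - x ^+ 2.
Proof.
move=> x0; rewrite /phi => xphi.
have s0 : 0 <= Num.sqrt (5 : R) by rewrite sqrtr_ge0.
have s2 : Num.sqrt (5 : R) ^+ 2 = 5 by rewrite sqr_sqrtr // ler0n.
move: s0 s2 xphi; move: (Num.sqrt _) => s s0 s2 xphi.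
have : 2 * x + 1 < s by lra.
(* Squaring gives [4 * x ^+ 2 + 4 * x + 1 < 5]. *)
by move=> h; rewrite expr2 in s2 *; nra.
Qed.

Lemma q_sum_mul_bound (R : realType) (x : R) k L :
  0 < x -> 0 < 1 - x - x ^+ 2 ->
  x ^+ k * (1 + x) ^+ k * (\sum_(0 <= n < L) (q n)%:R * x ^+ n) <=
  x / (1 - x - x ^+ 2) - x ^+ (4 + 2 * k)%N
  - \sum_(0 <= n < (2 * k).+1) ((fib n)%:R - (S_ n k)%:R) * x ^+ n.
Proof.
move=> x0 D0; have x0' := ltW x0.
(* Large enough for the first [L] terms of [q] and for the strict index [4 + 2 * k]. *)
set M := (L + 5 + 2 * k)%N.
have step1 : x ^+ k * (1 + x) ^+ k * (\sum_(0 <= n < L) (q n)%:R * x ^+ n)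
    <= \sum_(0 <= n < M) (S_ n k)%:R * x ^+ n.
  apply: le_trans (q_sum_mul_le_S_sum R x k (L + 5) x0').
  rewrite ler_wpM2l ?mulr_ge0 ?exprn_ge0 ?addr_ge0 //.
  rewrite [leRHS](big_cat_nat (n := L)) ?leq_addr //= lerDl.
  by apply: sumr_ge0 => n _; rewrite mulr_ge0 ?ler0n ?exprn_ge0.
have step2 : \sum_(0 <= n < M) (fib n)%:R * x ^+ n <= x / (1 - x - x ^+ 2).
  rewrite ler_pdivlMr // mulrC (_ : M = M.-1.+1) ?fib_sum_mul; last by rewrite /M; lia.
  by rewrite -addrA -opprD gerBl addr_ge0 // mulr_ge0 ?ler0n ?exprn_ge0.
have step3 : x ^+ (4 + 2 * k)%N <=
    \sum_((2 * k).+1 <= n < M) ((fib n)%:R - (S_ n k)%:R) * x ^+ n.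
  rewrite (bigD1_seq (4 + 2 * k)%N) /= ?iota_uniq //; last by rewrite mem_index_iota /M; lia.
  rewrite -[leLHS]addr0 lerD //.
    (* A strict inequality of naturals leaves a gap of at least 1. *)
    by rewrite ler_peMl ?exprn_ge0 // -natrB ?ler1n ?subn_gt0 ?S_lt_fib // ltnW ?S_lt_fib.
  rewrite big_seq_cond; apply: sumr_ge0 => n; rewrite mem_index_iota => /andP[/andP[h _] _].
  by rewrite mulr_ge0 ?exprn_ge0 // subr_ge0 ler_nat S_le_fib.
have split_sum : \sum_(0 <= n < M) (fib n)%:R * x ^+ n =
    \sum_(0 <= n < M) (S_ n k)%:R * x ^+ n +
    (\sum_(0 <= n < (2 * k).+1) ((fib n)%:R - (S_ n k)%:R) * x ^+ n +
     \sum_((2 * k).+1 <= n < M) ((fib n)%:R - (S_ n k)%:R) * x ^+ n).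
  rewrite -big_cat_nat //=; last by rewrite /M; lia.
  by rewrite -big_split /=; apply: eq_bigr => n _; rewrite -mulrDl addrC subrK.
lra.
Qed.

Theorem theorem5 (R : realType) (k : nat) (x : R)
    (hx0 : 0 < x) (hx1 : x < phi R - 1) :
  cvgn (euler_partial_prod x) /\
  limn (euler_partial_prod x) <
    1 / (x ^ (k%:Z - 1) * (1 + x) ^+ k * (1 - x - x ^+ 2))
    - 1 / (x ^+ k * (1 + x) ^+ k)
      * \sum_(0 <= n < (2 * k).+1) ((fib n)%:R - (S_ n k)%:R) * x ^+ n.
Proof.
have D0 := golden_denominator_gt0 R x hx0 hx1.
have x0 := ltW hx0.
have xk0 : 0 < x ^+ k * (1 + x) ^+ k by rewrite mulr_gt0 ?exprn_gt0 // addr_gt0.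
set sum := \sum_(_ <= _ < _) _.
(* The subtracted [x ^+ (4 + 2 * k)] does not depend on [N], so the strict inequality survives the
   limit. *)
pose B := (x / (1 - x - x ^+ 2) - x ^+ (4 + 2 * k)%N - sum) / (x ^+ k * (1 + x) ^+ k).
have PB N : euler_partial_prod x N <= B.
  have [L hL] := euler_partial_prod_le_q R x N x0.
  apply: le_trans hL _; rewrite /B ler_pdivlMr // mulrC.
  exact: q_sum_mul_bound.
have cvgP : cvgn (euler_partial_prod x).
  apply: nondecreasing_is_cvgn; last by exists B => _ [N _ <-].
  apply/nondecreasing_seqP => N; rewrite /euler_partial_prod [leRHS]big_nat_recr //=.
  apply: ler_peMr; last by rewrite lerDl exprn_ge0.
  by apply: prodr_ge0 => i _; rewrite addr_ge0 ?exprn_ge0.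
split=> //; apply: (@le_lt_trans _ _ B).
  by apply: limr_le => //; apply: nearW.
have -> : x ^ (k%:Z - 1) = x ^+ k / x by rewrite expfzDr ?gt_eqF // exprN1.
have -> : 1 / (x ^+ k / x * (1 + x) ^+ k * (1 - x - x ^+ 2)) - 1 / (x ^+ k * (1 + x) ^+ k) * sum
   = (x / (1 - x - x ^+ 2) - sum) / (x ^+ k * (1 + x) ^+ k).
  by field; rewrite (gt_eqF D0) !gt_eqF ?exprn_gt0 // addr_gt0.
by rewrite /B ltr_pM2r ?invr_gt0 // ltrD2r gtrBl exprn_gt0.
Qed.
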